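(* For small $\varepsilon>0$ let $p,q$ be the distributions on $\{1,2,3\}$ given by $$p=\left(\tfrac12-10\varepsilon,\ \tfrac12+8\varepsilon,\ 2\varepsilon\right),\qquad q=\left(\tfrac12,\ \tfrac12,\ 0\right).$$ Then $d_{\mathrm{TV}}(p,q)=10\varepsilon$. Moreover, the following hold for all sufficiently small $\varepsilon>0$: (i) (TV contamination) For every $0<t<1/2$, if $\varepsilon_2=\varepsilon$ and $\varepsilon_1=\varepsilon-\varepsilon^{1+t}$, then $0<\varepsilon_1<\varepsilon_2\le d_{\mathrm{TV}}(p,q)/4$, and $n^*_{\mathrm{TV}}(\varepsilon_2)\asymp\frac1{\varepsilon^2}$ and $n^*_{\mathrm{TV}}(\varepsilon_1)\asymp\frac{1}{\varepsilon^{1+2t}}$. (ii) (Huber contamination) For every $0<t<1/2$, if $\varepsilon_2=\frac{2\varepsilon}{1+2\varepsilon}$ and $\varepsilon_1=\varepsilon_2-\varepsilon^{1+t}$, then $0<\varepsilon_1<\varepsilon_2\le d_{\mathrm{TV}}(p,q)/4$, and $n^*_{\mathrm{Hub}}(\varepsilon_2)\asymp\frac1{\varepsilon^2}$ and $n^*_{\mathrm{Hub}}(\varepsilon_1)\asymp\frac{1}{\varepsilon^{1+2t}}$. (iii) (Subtractive contamination) For every $0<t<1$, if $\varepsilon_2=\frac{2\varepsilon}{1-2\varepsilon}$ and $\varepsilon_1=\varepsilon_2-\varepsilon^{1+t}$, then $0<\varepsilon_1<\varepsilon_2\le d_{\mathrm{TV}}(p,q)/4$, and $n^*_{\mathrm{Sub}}(\varepsilon_2)\asymp\frac1{\varepsilon^2}$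 and $n^*_{\mathrm{Sub}}(\varepsilon_1)\asymp\frac{1}{\varepsilon^{1+t}}$.
   Context: $\mathcal X$ is a finite set (here $\{1,2,3\}$) and $\Delta(\mathcal X)$ is the set of probability distributions on it. $d_{\mathrm{TV}}(p,q)=\frac12\sum_x|p(x)-q(x)|$. For $0\le\eta<1$ the uncertainty sets around $p$ are $\mathcal P_{\mathrm{Hub}}(p,\eta)=\{(1-\eta)p+\eta h: h\in\Delta(\mathcal X)\}$, $\mathcal P_{\mathrm{TV}}(p,\eta)=\{p'\in\Delta(\mathcal X): d_{\mathrm{TV}}(p',p)\le\eta\}$, $\mathcal P_{\mathrm{Sub}}(p,\eta)=\{p'\in\Delta(\mathcal X): p'(x)\le(1+\eta)p(x)\ \forall x\}$. For $A\in\{\mathrm{Hub},\mathrm{TV},\mathrm{Sub}\}$, the sample complexity $n^*_A(\eta)$ (for the given $p,q$) is the smallest $n$ for which there is a (possibly randomised) test $\phi:\mathcal X^n\to\{0,1\}$ with $$\sup_{P\in\mathcal P_A(p,\eta)}\mathbb P_{X^n\sim P^{\otimes n}}(\phi(X^n)=1)+\sup_{Q\in\mathcal P_A(q,\eta)}\mathbb P_{X^n\sim Q^{\otimes n}}(\phi(X^n)=0)\le\tfrac1{10}$$ ($n^*_A(\eta)=\infty$ if there is none). $f\asymp g$ means $c\,g\le f\le C\,g$ with universal constants $c,C>0$. *)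

(* Defs.v *)
From HB Require Import structures.
From mathcomp Require Import all_boot all_order all_algebra.
From mathcomp Require Import all_classical all_reals all_analysis.

Set Implicit Arguments.
Unset Strict Implicit.
Unset Printing Implicit Defensive.

Import Order.TTheory GRing.Theory Num.Theory.

Local Open Scope classical_set_scope.
Local Open Scope ring_scope.

Definition Delta (R : realType) (X : finType) : set (X -> R) :=
  [set p | (forall x, 0 <= p x) /\ \sum_x p x = 1].

Definition dTV (R : realType) (X : finType) (p q : X -> R) : R :=
  2^-1 * \sum_x `|p x - q x|.

Inductive contamination := Huber | TV | Subtractive.

Definition uncertainty (R : realType) (X : finType) (A : contamination)
    (p : X -> R) (eta : R) : set (X -> R) :=
  match A with
  | Huber => [set p' | exists2 h, Delta h &
                       p' = (fun x => (1 - eta) * p x + eta * h x)]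
  | TV => [set p' | Delta p' /\ dTV p' p <= eta]
  | Subtractive => [set p' | Delta p' /\ forall x, p' x <= (1 + eta) * p x]
  end.

Definition prod_mass (R : realType) (X : finType) (P : X -> R) (n : nat)
    (x : {ffun 'I_n -> X}) : R :=
  \prod_(i < n) P (x i).

(* A randomised test on X^n is represented by the map sending a sample x to
   the conditional probability [phi x] of outputting 1 given x. *)
Definition is_test (R : realType) (X : finType) (n : nat)
    (phi : {ffun 'I_n -> X} -> R) : Prop :=
  forall x, 0 <= phi x <= 1.

Definition prob_output1 (R : realType) (X : finType) (n : nat)
    (P : X -> R) (phi : {ffun 'I_n -> X} -> R) : R :=
  \sum_x prod_mass P x * phi x.

Definition prob_output0 (R : realType) (X : finType) (n : nat)
    (P : X -> R) (phi : {ffun 'I_n -> X} -> R) : R :=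
  \sum_x prod_mass P x * (1 - phi x).

Definition testable (R : realType) (X : finType) (A : contamination)
    (p q : X -> R) (eta : R) (n : nat) : Prop :=
  exists2 phi : {ffun 'I_n -> X} -> R, is_test phi &
    (ereal_sup [set (prob_output1 P phi)%:E | P in uncertainty A p eta]
     + ereal_sup [set (prob_output0 Q phi)%:E | Q in uncertainty A q eta]
     <= (10^-1)%:E)%E.

Definition sample_complexity (R : realType) (X : finType) (A : contamination)
    (p q : X -> R) (eta : R) : \bar R :=
  match pselect (exists n, `[< testable A p q eta n >]) with
  | left ex => ((ex_minn ex)%:R)%:E
  | right _ => +oo%E
  end.

(* The constants are explicit so that a statement can quantify them before
   every parameter on which f and g depend. *)
Definition asymp_with (R : realType) (c C : R) (f : \bar R) (g : R) : Prop :=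
  ((c * g)%:E <= f)%E /\ (f <= (C * g)%:E)%E.

(* The points 1, 2, 3 of the sample space are the ordinals 0, 1, 2 of 'I_3. *)
Definition p_eps (R : realType) (eps : R) (x : 'I_3) : R :=
  [:: 2^-1 - 10 * eps; 2^-1 + 8 * eps; 2 * eps]`_x.

Definition q_ref (R : realType) (x : 'I_3) : R :=
  [:: 2^-1; 2^-1; 0]`_x.

(* Main.v *)
(* Upper bounds: the test compares the number of occurrences of one point k with
   n * tau, where tau separates P(k) from Q(k) uniformly over the uncertainty
   sets, and Chebyshev's inequality controls its errors.  At eps2 the second
   point has a gap of order eps.  Below eps2, with delta = eps2 - eps1, the third
   point has a gap of order delta but mass only O(eps) for TV and Huber, giving
   n ~ eps / delta^2; for subtractive contamination Q(3) = 0, giving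
   n ~ 1 / delta.

   Lower bounds: for one P and one Q in the uncertainty sets, the error sum of
   any test is at least 1 - (1 + chi2)^n / 4, so n * chi2(Q || P) must exceed a
   constant.  Moving the contaminating mass on or off the third point makes chi2
   of order eps^2 + delta^2 / eps, respectively eps^2 + delta. *)

Require Import Defs.
From HB Require Import structures.
From mathcomp Require Import all_boot all_order all_algebra.
From mathcomp Require Import all_classical all_reals all_analysis.
From mathcomp Require Import ring lra.

Set Implicit Arguments.
Unset Strict Implicit.

Import Order.TTheory GRing.Theory Num.Theory.

Local Open Scope ring_scope.

(** * Chi-square divergence and moments of product measures *)

Definition chi2 {R : realType} {X : finType} (P Q : X -> R) : R :=
  \sum_x (Q x - P x) ^+ 2 / P x.

Section ProductMeasure.
Context {R : realType} {X : finType}.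
Implicit Types (P Q : X -> R) (n : nat).

Lemma prod_mass_ge0 P n (x : {ffun 'I_n -> X}) :
  (forall y, 0 <= P y) -> 0 <= prod_mass P x.
Proof. by move=> P0; apply: prodr_ge0. Qed.

Lemma sum_prod_mass P n :
  \sum_(x : {ffun 'I_n -> X}) prod_mass P x = (\sum_y P y) ^+ n.
Proof.
by rewrite /prod_mass -(bigA_distr_bigA (fun=> P)) prodr_const card_ord.
Qed.

Lemma sum_prod_mass1 P n :
  Delta P -> \sum_(x : {ffun 'I_n -> X}) prod_mass P x = 1.
Proof. by case=> _ P1; rewrite sum_prod_mass P1 expr1n. Qed.

(** Expanding the square, the cross terms vanish because the coordinates are independent and [f] is
    centred under [P]; only the diagonal survives. *)
Lemma second_moment_prod_mass P (f : X -> R) n :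
  \sum_y P y = 1 -> \sum_y P y * f y = 0 ->
  \sum_(x : {ffun 'I_n -> X}) prod_mass P x * (\sum_i f (x i)) ^+ 2
  = n%:R * \sum_y P y * f y ^+ 2.
Proof.
move=> P1 Pf0.
(* The product over [l] of these factors is the weight of [x] times [f (x i) * f (x j)], also when
   [i = j], so each sum over samples factorises into sums over single coordinates. *)
pose G i j (l : 'I_n) y :=
  P y * ((if l == i then f y else 1) * (if l == j then f y else 1)).
transitivity (\sum_(i < n) \sum_(j < n)
    \sum_(x : {ffun 'I_n -> X}) \prod_l G i j l (x l)).
  rewrite [RHS](eq_bigr (fun i => \sum_(x : {ffun 'I_n -> X})
      \sum_(j < n) \prod_l G i j l (x l))); last by move=> i _; rewrite exchange_big.
  rewrite exchange_big; apply: eq_bigr => x _.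
  rewrite expr2 big_distrlr /= mulr_sumr; apply: eq_bigr => i _.
  rewrite mulr_sumr; apply: eq_bigr => j _.
  by rewrite /G !big_split -!big_mkcond !big_pred1_eq.
transitivity (\sum_(i < n) \sum_y P y * f y ^+ 2); last first.
  by rewrite sumr_const card_ord mulr_natl.
apply: eq_bigr => i _; rewrite (bigD1 i) //= [X in _ + X]big1 ?addr0.
  rewrite -(bigA_distr_bigA (G i i)) (bigD1 i) //= [X in _ * X]big1 ?mulr1.
    by apply: eq_bigr => y _; rewrite /G eqxx.
  by move=> l /negbTE li; rewrite -[RHS]P1; apply: eq_bigr => y _; rewrite /G li !mulr1.
move=> j /negbTE ji; rewrite -(bigA_distr_bigA (G i j)) (bigD1 i) //=.
rewrite (eq_bigr (fun y => P y * f y)) ?Pf0 ?mul0r // => y _.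
by rewrite /G eqxx eq_sym ji mulr1.
Qed.

Lemma count_variance P (k : X) n : Delta P ->
  \sum_(x : {ffun 'I_n -> X})
     prod_mass P x * (\sum_i (x i == k)%:R - n%:R * P k) ^+ 2
  = n%:R * (P k * (1 - P k)).
Proof.
move=> [_ P1]; have Pk : \sum_y P y * (y == k)%:R = P k.
  by rewrite (bigD1 k) //= eqxx mulr1 big1 ?addr0 // => y /negbTE ->; rewrite mulr0.
rewrite (_ : P k * (1 - P k) = \sum_y P y * ((y == k)%:R - P k) ^+ 2).
  rewrite -second_moment_prod_mass //.
    apply: eq_bigr => x _; congr (_ * _ ^+ 2).
    by rewrite sumrB sumr_const card_ord mulr_natl.
  rewrite (eq_bigr (fun y => P y * (y == k)%:R - P y * P k)); last by move=> y _; ring.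
  by rewrite sumrB Pk -mulr_suml P1; ring.
rewrite (eq_bigr (fun y => P y * (y == k)%:R * (1 - 2 * P k) + P y * P k ^+ 2)).
  by rewrite big_split /= -!mulr_suml Pk P1; ring.
by move=> y _; case: (y == k) => /=; ring.
Qed.

Lemma chebyshev_count P (k : X) n (m : R) (D : pred {ffun 'I_n -> X}) :
  Delta P -> 0 < m ->
  (forall x, D x -> m <= `|\sum_i (x i == k)%:R - n%:R * P k|) ->
  \sum_x prod_mass P x * (D x)%:R <= n%:R * (P k * (1 - P k)) / m ^+ 2.
Proof.
move=> PD m0 Dm; rewrite -count_variance // mulr_suml; apply: ler_sum => x _.
have pm0 : 0 <= prod_mass P x by apply: prod_mass_ge0; case: PD.
rewrite -mulrA ler_wpM2l // ler_pdivlMr ?exprn_gt0 //.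
case Dx: (D x); last by rewrite mul0r sqr_ge0.
by rewrite mul1r -[leRHS]real_normK ?num_real // lerXn2r ?nnegrE ?(ltW m0) ?Dm.
Qed.

(** Tensorisation: the second moment of the likelihood ratio under [P] is multiplicative over the
    coordinates. This turns a bound on [n] samples into a power of a one-sample quantity. *)
Lemma sum_sqr_div P Q n :
  \sum_(x : {ffun 'I_n -> X}) prod_mass Q x ^+ 2 / prod_mass P x
  = (\sum_y Q y ^+ 2 / P y) ^+ n.
Proof.
rewrite -sum_prod_mass; apply: eq_bigr => x _.
by rewrite /prod_mass -prodrXl -prodf_div.
Qed.

(** Pointwise, [Q^2 / P = (Q - P)^2 / P + 2 Q - P], and the linear part sums to 1. The support
    condition is there because division by 0 gives 0, so mass of [Q] outside the support of [P]
    would go uncounted. *)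
Lemma sum_sqr_div_chi2 P Q : Delta P -> Delta Q ->
  (forall y, P y = 0 -> Q y = 0) -> \sum_y Q y ^+ 2 / P y = 1 + chi2 P Q.
Proof.
move=> [_ P1] [_ Q1] PQ.
rewrite (_ : 1 + _ = \sum_y ((Q y - P y) ^+ 2 / P y + (2 * Q y - P y))); last first.
  by rewrite big_split /= sumrB -mulr_sumr P1 Q1 /chi2; ring.
apply: eq_bigr => y _; have [P0|P0] := eqVneq (P y) 0; last by field.
by rewrite PQ // P0; ring.
Qed.

(* Pointwise, [Q - P <= Q^2 / (4 P)] by AM-GM. *)
Lemma error_sum_ge P Q n (phi : {ffun 'I_n -> X} -> R) :
  Delta P -> Delta Q -> (forall y, P y = 0 -> Q y = 0) -> is_test phi ->
  1 - (1 + chi2 P Q) ^+ n / 4 <= prob_output1 P phi + prob_output0 Q phi.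
Proof.
move=> PD QD PQ phiT.
rewrite -sum_sqr_div_chi2 // -sum_sqr_div -[X in X - _](sum_prod_mass1 n QD).
rewrite mulr_suml -sumrB -big_split /=; apply: ler_sum => x _.
have [/andP[f0 f1]] := (phiT x).
have P0 : 0 <= prod_mass P x by apply: prod_mass_ge0; case: PD.
have Q0 : 0 <= prod_mass Q x by apply: prod_mass_ge0; case: QD.
have [Px|Px] := eqVneq (prod_mass P x) 0.
  have -> : prod_mass Q x = 0.
    by have /prodf_eq0[i _ /eqP/PQ/eqP Qi] := introT eqP Px; apply/eqP/prodf_eq0; exists i.
  by rewrite Px; lra.
have Pgt : 0 < prod_mass P x by rewrite lt_neqAle eq_sym Px.
move: (prod_mass P x) (prod_mass Q x) (phi x) P0 Q0 Px Pgt f0 f1 => a b c _ b0 an a0 c0 c1.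
have : b - a <= b ^+ 2 / a / 4.
  rewrite -subr_ge0 (_ : _ - _ = (b - 2 * a) ^+ 2 / a / 4); last by field.
  by rewrite !divr_ge0 ?sqr_ge0 // ltW.
have : 0 <= b ^+ 2 / a / 4 by rewrite !divr_ge0 ?sqr_ge0 // ltW.
by move: (_ / 4) => s; nra.
Qed.

End ProductMeasure.

(** * From error bounds to bounds on the sample complexity *)

Lemma one_plus_pow_le {R : realType} (a : R) (n : nat) :
  0 <= a -> n%:R * a <= 2^-1 -> (1 + a) ^+ n <= 2.
Proof.
(* This form goes through induction since [(1 - (n + 1) a) (1 + a) <= 1 - n a]; as [1 - n a >= 1/2],
   it gives the bound 2. *)
move=> a0 na; suff H : (1 - n%:R * a) * (1 + a) ^+ n <= 1.
  have : 0 <= (1 + a) ^+ n by rewrite exprn_ge0 // addr_ge0.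
  move: ((1 + a) ^+ n) H => s; nra.
elim: n na => [|n IH] na; first by rewrite expr0; lra.
rewrite -natr1 in na *.
have na0 : 0 <= n%:R * a by rewrite mulr_ge0.
apply: le_trans (IH _); last by nra.
rewrite exprS mulrA ler_wpM2r ?exprn_ge0 ?addr_ge0 //; nra.
Qed.

Section SampleComplexity.
Context {R : realType} {X : finType}.
Implicit Types (A : contamination) (p q P Q : X -> R) (eta : R) (n : nat).

(** Were [n * chi2 P Q < 1/2], the power [(1 + chi2 P Q)^n] would be at most 2, so the error sum
    would be at least [1 - 2/4 = 1/2], well above [1/10]. *)
Lemma testable_chi2 A p q eta n P Q :
  uncertainty A p eta P -> uncertainty A q eta Q ->
  Delta P -> Delta Q -> (forall y, P y = 0 -> Q y = 0) ->
  testable A p q eta n -> 2^-1 <= n%:R * chi2 P Q.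
Proof.
move=> UP UQ PD QD PQ [phi phiT le_err].
rewrite leNgt; apply/negP => small.
have chi0 : 0 <= chi2 P Q.
  by apply: sumr_ge0 => y _; rewrite divr_ge0 ?sqr_ge0 //; case: PD.
have := one_plus_pow_le chi0 (ltW small).
have := error_sum_ge PD QD PQ phiT.
have : prob_output1 P phi + prob_output0 Q phi <= 10^-1.
  rewrite -lee_fin; apply: le_trans le_err; rewrite EFinD; apply: leeD.
    by apply: ereal_sup_ubound; exists P.
  by apply: ereal_sup_ubound; exists Q.
lra.
Qed.

(** The test outputs 1 when [k] occurs fewer than [n * tau] times. The count has variance at most
    [n] times the mass of [k], and the lower bound on [n] makes Chebyshev give at most [1/20] for
    each error. *)
Lemma testable_count A p q eta n (k : X) (tau g : R) :
  0 <= tau -> 0 < g -> 20 * (tau + g) <= n%:R * g ^+ 2 ->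
  (forall P, uncertainty A p eta P -> Delta P /\ tau + g <= P k) ->
  (forall Q, uncertainty A q eta Q -> Delta Q /\ Q k <= tau - g) ->
  testable A p q eta n.
Proof.
move=> tau0 g0 ng HP HQ.
have g20 : 0 < g ^+ 2 by rewrite exprn_gt0.
have n0 : 0 < n%:R :> R.
  by rewrite -(pmulr_lgt0 _ g20); apply: lt_le_trans ng; lra.
pose N (x : {ffun 'I_n -> X}) : R := \sum_i (x i == k)%:R.
exists (fun x => (N x < n%:R * tau)%R%:R) => [x|].
  by case: (_ < _) => /=; rewrite ?lexx ?ler01.
have -> : 10^-1 = 20^-1 + 20^-1 :> R by lra.
rewrite EFinD; apply: leeD; apply: ge_ereal_sup => _ [P UP <-]; rewrite lee_fin.
  have [PD Pk] := HP P UP.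
  have Pk0 : 0 < P k - tau by lra.
  have := @chebyshev_count _ _ P k n (n%:R * (P k - tau)) (fun x => N x < n%:R * tau)%R PD.
  rewrite mulr_gt0 // => /(_ isT) H; apply: le_trans (H _) _.
    by move=> x; rewrite -/(N x) => Nx; rewrite ler0_norm; nra.
  rewrite ler_pdivrMr ?exprn_gt0 ?mulr_gt0 //.
  set s := P k - tau in Pk0 *; have sg : g <= s by rewrite /s; lra.
  have Ps : P k = tau + s by rewrite /s; lra.
  (* A larger [P k] increases the variance as well as the gap [s]. The ratio [(tau + s) / s^2]
     decreases in [s], so the worst case is [s = g]. *)
  have H1 : (tau + s) * g ^+ 2 <= (tau + g) * s ^+ 2.
    rewrite -subr_ge0 (_ : _ - _ = (s - g) * (tau * (s + g) + g * s)); last by ring.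
    by rewrite mulr_ge0 ?subr_ge0 // addr_ge0 ?mulr_ge0 //; lra.
  have H2 : 20 * (tau + s) <= n%:R * s ^+ 2.
    rewrite -(ler_pM2r g20).
    have : 20 * (tau + g) * s ^+ 2 <= n%:R * g ^+ 2 * s ^+ 2 by rewrite ler_wpM2r ?sqr_ge0.
    lra.
  have H3 : 0 <= P k ^+ 2 by rewrite sqr_ge0.
  have : n%:R * (20 * (P k * (1 - P k))) <= n%:R * (n%:R * s ^+ 2).
    by rewrite ler_pM2l //; lra.
  lra.
have [PD Pk] := HQ P UP.
have Pk0 : 0 < tau - P k by lra.
have Pp : 0 <= P k by case: PD.
have := @chebyshev_count _ _ P k n (n%:R * (tau - P k)) (fun x => ~~ (N x < n%:R * tau)) PD.
rewrite mulr_gt0 // => /(_ isT) H; apply: le_trans (le_trans (H _) _).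
- by apply: ler_sum => x _; case: (_ < _); rewrite /= ?subrr ?subr0.
- by move=> x; rewrite -leNgt -/(N x) => Nx; rewrite ger0_norm; nra.
rewrite ler_pdivrMr ?exprn_gt0 ?mulr_gt0 //.
have H2 : n%:R * g ^+ 2 <= n%:R * (tau - P k) ^+ 2.
  by rewrite ler_pM2l // lerXn2r ?nnegrE //; lra.
have H3 : 0 <= P k ^+ 2 by rewrite sqr_ge0.
have : n%:R * (20 * (P k * (1 - P k))) <= n%:R * (n%:R * (tau - P k) ^+ 2).
  by rewrite ler_pM2l //; lra.
lra.
Qed.

Lemma sample_complexity_le A p q eta n (x : R) :
  testable A p q eta n -> n%:R <= x -> (sample_complexity A p q eta <= x%:E)%E.
Proof.
move=> nT nx; rewrite /sample_complexity; case: pselect => [ex|[]]; last first.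
  by exists n; apply/asboolP.
case: ex_minnP => m _ /(_ n) H; rewrite lee_fin; apply: le_trans nx.
by rewrite ler_nat H //; apply/asboolP.
Qed.

Lemma sample_complexity_ge A p q eta (x : R) :
  (forall n, testable A p q eta n -> x <= n%:R) ->
  (x%:E <= sample_complexity A p q eta)%E.
Proof.
move=> H; rewrite /sample_complexity; case: pselect => [ex|_]; last by rewrite leey.
by case: ex_minnP => m /asboolP mT _; rewrite lee_fin H.
Qed.

(** The lower constant comes from [1/2 <= n * chi2 P Q] and [chi2 P Q * G <= 2000], hence
    [G <= 4000 n]. The upper constant comes from rounding [199 G] up to an integer, which costs at
    most [1 <= G]. *)
Lemma asymp_sample_complexity A p q eta (k : X) (tau g : R) P Q (G : R) :
  1 <= G -> 0 <= tau -> 0 < g -> 20 * (tau + g) <= 199 * G * g ^+ 2 ->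
  (forall P, uncertainty A p eta P -> Delta P /\ tau + g <= P k) ->
  (forall Q, uncertainty A q eta Q -> Delta Q /\ Q k <= tau - g) ->
  uncertainty A p eta P -> uncertainty A q eta Q ->
  (forall y, P y = 0 -> Q y = 0) -> chi2 P Q * G <= 2000 ->
  asymp_with 4000^-1 200 (sample_complexity A p q eta) G.
Proof.
move=> G1 tau0 g0 tg HP HQ UP UQ PQ chiG.
have g20 : 0 < g ^+ 2 by rewrite exprn_gt0.
split.
  apply: sample_complexity_ge => n nT.
  have := testable_chi2 UP UQ (HP _ UP).1 (HQ _ UQ).1 PQ nT.
  have : (0 : R) <= n%:R by [].
  nra.
have G0 : 0 <= 199 * G by lra.
(* The sample size is [m + 1]: it exceeds [199 G], as the counting test asks, and is at most
   [200 G]. *)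
set m := Num.truncn (199 * G).
have mS : m.+1%:R = m%:R + 1 :> R by rewrite natr1.
have /andP[lo hi] := truncn_itv G0; rewrite -/m mS in lo hi.
apply: (@sample_complexity_le _ _ _ _ m.+1); last by rewrite mS; lra.
apply: (testable_count (k := k) tau0 g0) => //; apply: le_trans tg _.
by rewrite ler_pM2r // mS ltW.
Qed.

End SampleComplexity.

(** * Uncertainty sets on three points and hard pairs within them *)

Lemma dTV_coord {R : realType} {X : finType} (P p : X -> R) (k : X) :
  Delta P -> Delta p -> `|P k - p k| <= dTV P p.
Proof.
move=> [_ P1] [_ p1]; rewrite /dTV (bigD1 k) //=.
(* Both have total mass 1, so a deviation at [k] is compensated elsewhere and enters the sum of
   absolute differences twice, which cancels the factor [1/2]. *)
have -> : P k - p k = - \sum_(x | x != k) (P x - p x).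
  have : \sum_x (P x - p x) = 0 by rewrite sumrB P1 p1 subrr.
  by rewrite (bigD1 k) //= => /eqP; rewrite addr_eq0 => /eqP.
rewrite normrN; have := ler_norm_sum (index_enum X) (fun x => P x - p x) (fun x => x != k).
lra.
Qed.

Lemma uncertainty_Delta {R : realType} {X : finType} (A : contamination)
    (p P : X -> R) (eta : R) :
  Delta p -> 0 <= eta <= 1 -> uncertainty A p eta P -> Delta P.
Proof.
move=> [p0 p1] /andP[e0 e1]; case: A => /= [[h [h0 h1] ->]|[]//|[]//].
split=> [x|]; last by rewrite big_split -!mulr_sumr p1 h1 /=; ring.
by rewrite addr_ge0 // mulr_ge0 // subr_ge0.
Qed.

Section ThreePoints.
Context {R : realType}.
Implicit Types (P Q : 'I_3 -> R) (a b c eps delta eta : R).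

Let i0 : 'I_3 := @Ordinal 3 0 isT.
Let i1 : 'I_3 := @Ordinal 3 1 isT.
Let i2 : 'I_3 := @Ordinal 3 2 isT.

Lemma sum3 (F : 'I_3 -> R) : \sum_x F x = F i0 + F i1 + F i2.
Proof.
rewrite !big_ord_recl big_ord0 addr0 addrA.
by congr (F _ + F _ + F _); exact: val_inj.
Qed.

Lemma forall3 (T : 'I_3 -> Prop) : T i0 -> T i1 -> T i2 -> forall x, T x.
Proof.
by move=> T0 T1 T2 [[|[|[|//]]] x3]; rewrite (bool_irrelevance x3 isT).
Qed.

Definition vec3 a b c (x : 'I_3) : R := [:: a; b; c]`_x.

Lemma Delta_vec3 a b c :
  0 <= a -> 0 <= b -> 0 <= c -> a + b + c = 1 -> Delta (vec3 a b c).
Proof. by move=> a0 b0 c0 abc; split; [exact: forall3 | rewrite sum3]. Qed.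

Lemma Delta_p_eps eps : 0 <= eps <= 20^-1 -> Delta (p_eps eps).
Proof. by move=> /andP[e0 e1]; apply: Delta_vec3; lra. Qed.

Lemma Delta_q_ref : Delta (q_ref R).
Proof. by apply: Delta_vec3; lra. Qed.

Lemma dTV_p_q eps : 0 <= eps -> dTV (p_eps eps) (q_ref R) = 10 * eps.
Proof.
move=> e0; rewrite /dTV sum3 /p_eps /q_ref /=.
by rewrite ler0_norm ?ger0_norm; lra.
Qed.

Lemma chi2_3_le P Q eps w :
  0 <= eps -> 4^-1 <= P i0 -> 4^-1 <= P i1 -> 0 <= P i2 -> 0 <= w ->
  `|Q i0 - P i0| <= 12 * eps -> `|Q i1 - P i1| <= 12 * eps ->
  (Q i2 - P i2) ^+ 2 <= w * P i2 -> chi2 P Q <= 1152 * eps ^+ 2 + w.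
Proof.
move=> e0 P0 P1 P2 w0 d0 d1 d2; rewrite /chi2 sum3.
(* Here [576 = 4 * 12^2]; the first two points together give [1152]. *)
have H a b : 4^-1 <= b -> `|a| <= 12 * eps -> a ^+ 2 / b <= 576 * eps ^+ 2.
  move=> b4 a12; rewrite ler_pdivrMr; last by lra.
  have : a ^+ 2 <= 144 * eps ^+ 2.
    rewrite -real_normK ?num_real // (_ : 144 * _ = (12 * eps) ^+ 2); last by ring.
    by rewrite lerXn2r ?nnegrE //; lra.
  have : 0 <= eps ^+ 2 * (b - 4^-1) by rewrite mulr_ge0 ?sqr_ge0 ?subr_ge0.
  lra.
have := H _ _ P0 d0; have := H _ _ P1 d1.
have : (Q i2 - P i2) ^+ 2 / P i2 <= w.
  (* The case [P i2 = 0] does occur, for the subtractive pair with [delta = 0]; the term is then 0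
     because [0^-1 = 0]. *)
  move: P2; rewrite le_eqVlt => /predU1P[<-|P2]; first by rewrite invr0 mulr0.
  by rewrite ler_pdivrMr.
lra.
Qed.

(* [w] bounds the contribution of the third point to the chi-square
   divergence; the first two contribute [O(eps^2)]. *)
Lemma asymp_p_q A eps eta G w (k : 'I_3) (tau g : R) P Q :
  0 < eps < 100^-1 -> 0 <= eta <= 1 ->
  1 <= G -> eps ^+ 2 * G <= 1 -> w * G <= 4 ->
  0 <= tau -> 0 < g -> 20 * (tau + g) <= 199 * G * g ^+ 2 ->
  (forall P, uncertainty A (p_eps eps) eta P -> Delta P -> tau + g <= P k) ->
  (forall Q, uncertainty A (q_ref R) eta Q -> Delta Q -> Q k <= tau - g) ->
  uncertainty A (p_eps eps) eta P -> uncertainty A (q_ref R) eta Q ->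
  0 <= w -> `|Q i0 - P i0| <= 12 * eps -> `|Q i1 - P i1| <= 12 * eps ->
  4^-1 <= P i0 -> 4^-1 <= P i1 -> (P i2 = 0 -> Q i2 = 0) ->
  (Q i2 - P i2) ^+ 2 <= w * P i2 ->
  asymp_with 4000^-1 200 (sample_complexity A (p_eps eps) (q_ref R) eta) G.
Proof.
move=> e01 etab G1 eG wG tau0 g0 tg HP HQ UP UQ w0 d0 d1 P0 P1 PQ2 d2.
have pD : Delta (p_eps eps) by apply: Delta_p_eps; lra.
have UDp P' : uncertainty A (p_eps eps) eta P' -> Delta P'.
  exact: uncertainty_Delta.
have UDq Q' : uncertainty A (q_ref R) eta Q' -> Delta Q'.
  by apply: uncertainty_Delta => //; exact: Delta_q_ref.
apply: (asymp_sample_complexity (k := k) (P := P) (Q := Q) G1 tau0 g0) => //.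
- by move=> P' UP'; split; [exact: UDp | apply: HP => //; exact: UDp].
- by move=> Q' UQ'; split; [exact: UDq | apply: HQ => //; exact: UDq].
- by apply: forall3 => //; lra.
have P2 : 0 <= P i2 by case: (UDp _ UP).
have chi : chi2 P Q <= 1152 * eps ^+ 2 + w by apply: chi2_3_le => //; lra.
have : chi2 P Q * G <= (1152 * eps ^+ 2 + w) * G by apply: ler_wpM2r => //; lra.
lra.
Qed.

(** Allowing [delta = 0] lets one statement cover both contamination levels: [delta] is the distance
    below the critical one. The Huber and subtractive versions follow the same pattern. *)
Lemma asymp_TV eps delta G (k : 'I_3) (tau g : R) :
  0 < eps < 100^-1 -> 0 <= delta < eps ->
  1 <= G -> eps ^+ 2 * G <= 1 -> delta ^+ 2 / eps * G <= 1 ->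
  0 <= tau -> 0 < g -> 20 * (tau + g) <= 199 * G * g ^+ 2 ->
  tau + g <= p_eps eps k - (eps - delta) ->
  q_ref R k + (eps - delta) <= tau - g ->
  asymp_with 4000^-1 200
    (sample_complexity TV (p_eps eps) (q_ref R) (eps - delta)) G.
Proof.
move=> e01 d0e G1 eG dG tau0 g0 tg pk qk.
have pD : Delta (p_eps eps) by apply: Delta_p_eps; lra.
(* Mass [eps - delta] moves from the third point to the first for [p], and the other way for [q].
   The third masses become [eps + delta] and [eps - delta]: they differ by [2 * delta], and agree at
   [delta = 0]. *)
apply: (@asymp_p_q _ _ _ _ (4 * (delta ^+ 2 / eps)) k tau g
  (vec3 (2^-1 - 9 * eps - delta) (2^-1 + 8 * eps) (eps + delta))
  (vec3 (2^-1 - eps + delta) 2^-1 (eps - delta))) => //=.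
- lra.
- lra.
- move=> P [PD Pd] _; have := dTV_coord k PD pD; rewrite ler_norml; lra.
- move=> Q [QD Qd] _; have := dTV_coord k QD Delta_q_ref; rewrite ler_norml; lra.
- split; first by apply: Delta_vec3; lra.
  rewrite /dTV sum3 /p_eps /vec3 /=.
  rewrite subrr normr0 (_ : _ - (_ - _) = eps - delta); last by ring.
  rewrite (_ : _ - 2 * _ = - (eps - delta)); last by ring.
  by rewrite normrN ger0_norm; lra.
- split; first by apply: Delta_vec3; lra.
  rewrite /dTV sum3 /q_ref /vec3 /=.
  by rewrite subrr normr0 ler0_norm ?ger0_norm; lra.
- by rewrite mulr_ge0 // divr_ge0 ?sqr_ge0 //; lra.
- by rewrite /vec3 /= ler_norml; lra.
- by rewrite /vec3 /= ler_norml; lra.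
- by rewrite /vec3 /=; lra.
- by rewrite /vec3 /=; lra.
- by rewrite /vec3 /=; lra.
have sE : delta ^+ 2 / eps * eps = delta ^+ 2 by rewrite divfK // gt_eqF //; lra.
have sd : 0 <= delta ^+ 2 / eps * delta.
  by rewrite mulr_ge0 // ?divr_ge0 ?sqr_ge0 //; lra.
rewrite /vec3 /=; move: (delta ^+ 2 / eps) sE sd => s; lra.
Qed.

Lemma Delta_le1 (X : finType) (h : X -> R) (k : X) : Delta h -> h k <= 1.
Proof.
move=> [h0 h1]; rewrite -h1 (bigD1 k) //= lerDl.
exact: sumr_ge0.
Qed.

Lemma asymp_Huber eps delta G (k : 'I_3) (tau g : R)
    (eta := 2 * eps / (1 + 2 * eps) - delta) :
  0 < eps < 100^-1 -> 0 <= delta < eps ->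
  1 <= G -> eps ^+ 2 * G <= 1 -> delta ^+ 2 / eps * G <= 1 ->
  0 <= tau -> 0 < g -> 20 * (tau + g) <= 199 * G * g ^+ 2 ->
  tau + g <= (1 - eta) * p_eps eps k ->
  (1 - eta) * q_ref R k + eta <= tau - g ->
  asymp_with 4000^-1 200 (sample_complexity Huber (p_eps eps) (q_ref R) eta) G.
Proof.
move=> e01 d0e G1 eG dG tau0 g0 tg pk qk.
have etaE : (eta + delta) * (1 + 2 * eps) = 2 * eps.
  by rewrite /eta subrK divfK // gt_eqF //; lra.
have eta0 : 0 <= eta by nra.
have eta1 : eta <= 2 * eps by nra.
have etab : 0 <= eta <= 1 by lra.
have sE : delta ^+ 2 / eps * eps = delta ^+ 2 by rewrite divfK // gt_eqF //; lra.
have s0 : 0 <= delta ^+ 2 / eps by rewrite divr_ge0 ?sqr_ge0 //; lra.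
have eta_eps : 0 <= eta * eps by rewrite mulr_ge0 //; lra.
have eta_eps2 : eta * eps <= eps * 50^-1 by nra.
(* [p] is contaminated at the first point and [q] at the third. The level [2 eps / (1 + 2 eps)]
   solves [(1 - eta) * 2 eps = eta], so the third masses agree at [delta = 0] and otherwise differ
   by [(1 + 2 eps) * delta]. *)
apply: (@asymp_p_q _ _ _ _ (4 * (delta ^+ 2 / eps)) k tau g
  (fun x => (1 - eta) * p_eps eps x + eta * vec3 1 0 0 x)
  (fun x => (1 - eta) * q_ref R x + eta * vec3 0 0 1 x)) => //=.
- lra.
- move=> P [h hD ->] _; apply: le_trans pk _.
  by rewrite lerDl mulr_ge0 //; case: hD.
- move=> Q [h hD ->] _; apply: le_trans qk; rewrite lerD2l.
  by rewrite ler_piMr // Delta_le1.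
- by exists (vec3 1 0 0) => //; apply: Delta_vec3; lra.
- by exists (vec3 0 0 1) => //; apply: Delta_vec3; lra.
- by rewrite mulr_ge0.
- by rewrite /vec3 /p_eps /q_ref /= ler_norml; lra.
- by rewrite /vec3 /p_eps /q_ref /= ler_norml; lra.
- by rewrite /vec3 /p_eps /=; lra.
- by rewrite /vec3 /p_eps /=; lra.
- by rewrite /vec3 /p_eps /=; lra.
rewrite /vec3 /p_eps /q_ref /=.
have -> : (1 - eta) * 0 + eta * 1 - ((1 - eta) * (2 * eps) + eta * 0)
    = - ((1 + 2 * eps) * delta) by lra.
move: (delta ^+ 2 / eps) sE s0 => s sE s0.
have P2 : 0 <= s * ((1 - eta) * (2 * eps) - eps) by rewrite mulr_ge0 //; lra.
have : 0 <= delta ^+ 2 * (4 - (1 + 2 * eps) ^+ 2).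
  by rewrite mulr_ge0 ?sqr_ge0 //; nra.
lra.
Qed.

Lemma asymp_Subtractive eps delta G (k : 'I_3) (tau g : R)
    (eta := 2 * eps / (1 - 2 * eps) - delta) :
  0 < eps < 100^-1 -> 0 <= delta < eps ->
  1 <= G -> eps ^+ 2 * G <= 1 -> delta * G <= 1 ->
  0 <= tau -> 0 < g -> 20 * (tau + g) <= 199 * G * g ^+ 2 ->
  tau + g <= 1 - (1 + eta) * (1 - p_eps eps k) ->
  (1 + eta) * q_ref R k <= tau - g ->
  asymp_with 4000^-1 200
    (sample_complexity Subtractive (p_eps eps) (q_ref R) eta) G.
Proof.
move=> e01 d0e G1 eG dG tau0 g0 tg pk qk.
have pD : Delta (p_eps eps) by apply: Delta_p_eps; lra.
have etaE : (eta + delta) * (1 - 2 * eps) = 2 * eps.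
  by rewrite /eta subrK divfK // gt_eqF //; lra.
have eta0 : 0 <= eta by nra.
have eta1 : eta <= 3 * eps by nra.
have etab : 0 <= eta <= 1 by lra.
have eta_eps : 0 <= eta * eps by rewrite mulr_ge0 //; lra.
have eta_eps2 : eta * eps <= eps * 30^-1 by nra.
have de0 : 0 <= delta * eps by rewrite mulr_ge0; lra.
have de1 : delta * eps <= delta * 100^-1 by nra.
(* [p] is inflated as far as allowed on the first two points, and the third keeps the remainder [1 -
   (1 + eta) (1 - 2 eps) = (1 - 2 eps) * delta]; [q] stays as it is. The third term of chi-square is
   then this remainder itself, at most [delta]. *)
apply: (@asymp_p_q _ _ _ _ delta k tau g
  (vec3 ((1 + eta) * (2^-1 - 10 * eps)) ((1 + eta) * (2^-1 + 8 * eps))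
        ((1 - 2 * eps) * delta))
  (q_ref R)) => //=.
- lra.
(* Subtractive contamination limits masses only from above; the lower bound at [k] comes from
   bounding the mass of all other points. *)
- move=> P [_ Pp] [P0 P1]; apply: le_trans pk _.
  have : \sum_(x | x != k) P x <= (1 + eta) * \sum_(x | x != k) p_eps eps x.
    by rewrite mulr_sumr; apply: ler_sum.
  move: P1; case: pD => _; rewrite (bigD1 k) //= [X in _ -> X = _ -> _](bigD1 k) //=.
  move: (\sum_(i | i != k) P i) (\sum_(i | i != k) p_eps eps i) => a b pb Pa.
  by rewrite (_ : b = 1 - p_eps eps k); lra.
- by move=> Q [_ Qq] _; apply: le_trans qk.
- split; first by apply: Delta_vec3; lra.
  by apply: forall3; rewrite /vec3 /p_eps /=; lra.
- split; first exact: Delta_q_ref.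
  by apply: forall3; rewrite /q_ref /=; lra.
- lra.
- by rewrite /vec3 /q_ref /= ler_norml; lra.
- by rewrite /vec3 /q_ref /= ler_norml; lra.
- by rewrite /vec3 /=; lra.
- by rewrite /vec3 /=; lra.
rewrite /vec3 /q_ref /=.
have : 0 <= delta * ((1 - 2 * eps) * delta) * (2 * eps) by rewrite !mulr_ge0 //; lra.
lra.
Qed.

End ThreePoints.

(** * Powers of [eps] and the choice of test points and thresholds *)

Lemma powR_scale {R : realType} (eps t : R) : 0 < eps < 1 -> 0 < t ->
  [/\ 0 < eps `^ (1 + t), eps `^ (1 + t) < eps,
      eps `^ (1 + t) ^+ 2 = eps `^ (1 + 2 * t) * eps &
      t <= 1 -> eps ^+ 2 <= eps `^ (1 + t)].
Proof.
move=> /andP[e0 e1] t0.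
have D s : eps `^ (1 + s) = eps * eps `^ s.
  by rewrite powRD ?powRr1 ?ltW // (gt_eqF e0) implybT.
split; first exact: powR_gt0.
- rewrite D -[X in _ < X]mulr1 ltr_pM2l //.
  have : eps `^ t < 1 `^ t by apply: gt0_ltr_powR; rewrite ?nnegrE //; lra.
  by rewrite powR1.
- by rewrite !D [2 * t]mulrC powRrM powR_mulrn ?powR_ge0 //; ring.
move=> t1; rewrite D expr2 ler_pM2l // -{1}[eps]powRr1 ?(ltW e0) //.
by apply: ger_powR => //; rewrite e0 ltW.
Qed.

Theorem theorem4p3 (R : realType) :
  exists c C eps0 : R, [/\ 0 < c, 0 < C, 0 < eps0 &
  forall eps : R, 0 < eps < eps0 ->
  let p : 'I_3 -> R := p_eps eps in
  let q : 'I_3 -> R := q_ref R in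
  [/\ Delta p /\ Delta q,
      dTV p q = 10 * eps,
      (forall t eps1 eps2 : R, 0 < t < 2^-1 ->
         eps2 = eps -> eps1 = eps - eps `^ (1 + t) ->
         [/\ 0 < eps1, eps1 < eps2, eps2 <= dTV p q / 4,
             asymp_with c C (sample_complexity TV p q eps2) (eps ^+ 2)^-1 &
             asymp_with c C (sample_complexity TV p q eps1)
               (eps `^ (1 + 2 * t))^-1]),
      (forall t eps1 eps2 : R, 0 < t < 2^-1 ->
         eps2 = 2 * eps / (1 + 2 * eps) -> eps1 = eps2 - eps `^ (1 + t) ->
         [/\ 0 < eps1, eps1 < eps2, eps2 <= dTV p q / 4,
             asymp_with c C (sample_complexity Huber p q eps2) (eps ^+ 2)^-1 &
             asymp_with c C (sample_complexity Huber p q eps1)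
               (eps `^ (1 + 2 * t))^-1]) &
      (forall t eps1 eps2 : R, 0 < t < 1 ->
         eps2 = 2 * eps / (1 - 2 * eps) -> eps1 = eps2 - eps `^ (1 + t) ->
         [/\ 0 < eps1, eps1 < eps2, eps2 <= dTV p q / 4,
             asymp_with c C (sample_complexity Subtractive p q eps2) (eps ^+ 2)^-1 &
             asymp_with c C (sample_complexity Subtractive p q eps1)
               (eps `^ (1 + t))^-1])]].
Proof.
exists 4000^-1, 200, 100^-1; split; [lra | lra | lra | move=> eps e01 p q].
have e1 : 0 < eps < 1 by lra.
have dpq : dTV p q = 10 * eps by apply: dTV_p_q; lra.
have e20 : 0 < eps ^+ 2 by rewrite exprn_gt0 //; lra.
have e2V : eps ^+ 2 * (eps ^+ 2)^-1 = 1 by rewrite divff // gt_eqF.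
have e2lt : eps ^+ 2 <= eps * 100^-1 by nra.
have inv_ge1 (u : R) : 0 < u -> u <= 1 -> 1 <= u^-1.
  by move=> u0 u1; rewrite invf_ge1.
have G21 : 1 <= (eps ^+ 2)^-1 by apply: inv_ge1 => //; lra.
have HubE : 2 * eps / (1 + 2 * eps) * (1 + 2 * eps) = 2 * eps.
  by rewrite divfK // gt_eqF //; lra.
have SubE : 2 * eps / (1 - 2 * eps) * (1 - 2 * eps) = 2 * eps.
  by rewrite divfK // gt_eqF //; lra.
split=> //.
- by split; [apply: Delta_p_eps; lra | exact: Delta_q_ref].
- move=> t eps1 eps2 t01 -> ->; have t0 : 0 < t by lra.
  have t20 : 0 < 2 * t by lra.
  (* With [D] the gap between the two levels, [D^2 = u * eps] turns the rate [eps / D^2] into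
     [1 / u]. The second use, at [2 * t], gives [eps^2 <= u]; this is where [t < 1/2] enters. *)
  have [D0 De D2 _] := powR_scale e1 t0.
  have [u0 ue _ /(_ ltac:(lra)) ule] := powR_scale e1 t20.
  set D := eps `^ (1 + t) in D0 De D2 *; set u := eps `^ (1 + 2 * t) in D2 u0 ue ule *.
  have uV : u * u^-1 = 1 by rewrite divff // gt_eqF.
  have uV0 : 0 < u^-1 by rewrite invr_gt0.
  split; [lra | lra | lra | |].
    (* The critical level is the case [delta = 0]. At the second point every [P] has mass at least
       [1/2 + 7 eps] and every [Q] at most [1/2 + eps]; [tau] is the midpoint and [g] half the
       difference. *)
    rewrite -[X in sample_complexity _ _ _ X]subr0.
    apply: (@asymp_TV _ _ 0 _ (@Ordinal 3 1 isT) (2^-1 + 4 * eps) (3 * eps)) => //;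
      rewrite ?expr0n ?mul0r /p_eps /q_ref /=; lra.
  (* At the third point the extreme masses are [2 eps - (eps - D) = eps + D] and [eps - D]. *)
  apply: (@asymp_TV _ _ _ _ (@Ordinal 3 2 isT) eps D) => //.
  + lra.
  + by apply: inv_ge1; lra.
  + by rewrite -uV ler_pM2r.
  + by rewrite D2 mulfK ?uV // gt_eqF //; lra.
  + lra.
  + by rewrite D2 (_ : 199 * _ * _ = 199 * (u * u^-1) * eps); [rewrite uV; lra | ring].
  + by rewrite /p_eps /=; lra.
  + by rewrite /q_ref /=; lra.
- move=> t eps1 eps2 t01 -> ->; have t0 : 0 < t by lra.
  have t20 : 0 < 2 * t by lra.
  have [D0 De D2 _] := powR_scale e1 t0.
  have [u0 ue _ /(_ ltac:(lra)) ule] := powR_scale e1 t20.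
  set D := eps `^ (1 + t) in D0 De D2 *; set u := eps `^ (1 + 2 * t) in D2 u0 ue ule *.
  have uV : u * u^-1 = 1 by rewrite divff // gt_eqF.
  have uV0 : 0 < u^-1 by rewrite invr_gt0.
  have H1 : eps < 2 * eps / (1 + 2 * eps) by rewrite ltr_pdivlMr; nra.
  have H2 : 2 * eps / (1 + 2 * eps) <= 2 * eps by rewrite ler_pdivrMr; nra.
  have H3 : 2 * eps / (1 + 2 * eps) * eps <= 2 * eps * eps by rewrite ler_wpM2r //; lra.
  split; [lra | lra | lra | |].
    rewrite -[X in sample_complexity _ _ _ X]subr0.
    apply: (@asymp_Huber _ _ 0 _ (@Ordinal 3 1 isT) (2^-1 + 4 * eps) (2 * eps)) => //;
      rewrite ?expr0n ?mul0r /p_eps /q_ref /=; lra.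
  (* At the third point [Q] has mass at most [eps2 - D], while [P] has at least
     [(1 - eps1) * 2 eps = eps2 + 2 eps * D]; the threshold is centred between [eps2 - D] and
     [eps2]. *)
  apply: (@asymp_Huber _ _ _ _ (@Ordinal 3 2 isT)
    (2 * eps / (1 + 2 * eps) - D / 2) (D / 2)) => //.
  + lra.
  + by apply: inv_ge1; lra.
  + by rewrite -uV ler_pM2r.
  + by rewrite D2 mulfK ?uV // gt_eqF //; lra.
  + lra.
  + lra.
  + rewrite exprMn D2 (_ : 199 * _ * _ = 199 * (u * u^-1) * eps * 2^-1 ^+ 2); last by ring.
    by rewrite uV; lra.
  + have : 0 <= D * eps by rewrite mulr_ge0; lra.
    by rewrite /p_eps /=; lra.
  + by rewrite /q_ref /=; lra.
move=> t eps1 eps2 t01 -> ->; have t0 : 0 < t by lra.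
have [D0 De _ /(_ ltac:(lra)) Dle] := powR_scale e1 t0.
set D := eps `^ (1 + t) in D0 De Dle *.
have DV : D * D^-1 = 1 by rewrite divff // gt_eqF.
have DV0 : 0 < D^-1 by rewrite invr_gt0.
have H1 : 2 * eps < 2 * eps / (1 - 2 * eps) by rewrite ltr_pdivlMr; nra.
have H2 : 2 * eps / (1 - 2 * eps) <= 5 / 2 * eps by rewrite ler_pdivrMr; nra.
have H3 : 2 * eps / (1 - 2 * eps) * eps <= 5 / 2 * eps * eps by rewrite ler_wpM2r //; lra.
split; [lra | lra | lra | |].
  rewrite -[X in sample_complexity _ _ _ X]subr0.
  apply: (@asymp_Subtractive _ _ 0 _ (@Ordinal 3 1 isT) (2^-1 + 4 * eps) (2 * eps)) => //;
    rewrite ?mul0r /p_eps /q_ref /=; lra.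
have DG : 1 <= D^-1 by apply: inv_ge1; lra.
(* Here [Q] has no mass at the third point, so [tau = g], while [P] keeps at least
   [(1 - 2 eps) * D >= D / 2]. As [tau] is itself of order [D], a sample of order [1 / D] is
   enough. *)
apply: (@asymp_Subtractive _ _ _ _ (@Ordinal 3 2 isT) (D / 4) (D / 4)) => //.
- lra.
- by rewrite -DV ler_pM2r.
- by rewrite DV.
- lra.
- lra.
- by rewrite (_ : 199 * _ * _ = 199 * (D * D^-1) * D / 16); [rewrite DV; lra | field; lra].
- have : D * eps <= D * 100^-1 by rewrite ler_pM2l //; lra.
  by rewrite /p_eps /=; lra.
- by rewrite /q_ref /=; lra.
Qed.
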